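(* Let $(V,\rho,\alpha_V,\beta_V)$ be a representation of a multiplicative regular BiHom-Jordan superalgebra $(\mathfrak J,\cdot,\alpha,\beta)$. Define $\rho^\star:\mathfrak J\to End(V^* )$ by $$\rho^\star(x)(\xi)=\widetilde\rho(\beta(x))\big((\beta_V^{-2})^*(\xi)\big),\qquad x\in\mathcal H(\mathfrak J),\ \xi\in\mathcal H(V^* ),$$ where $\widetilde\rho(x)(f)=(-1)^{|f||x|}f\circ\rho(x)$ for $x\in\mathcal H(\mathfrak J)$, $f\in\mathcal H(V^* )$. Then $(V^*,\rho^\star,(\alpha_V^{-1})^*,(\beta_V^{-1})^* )$ is a representation of $(\mathfrak J,\cdot,\alpha,\beta)$ on $V^*$.
   Context: Vector spaces are over an algebraically closed field $\mathbb K$ of characteristic $0$. For a $\mathbb Z_2$-graded vector space $W$, $\mathcal H(W)$ denotes the set of homogeneous elements and $|x|$ the parity of $x$; even (bi)linear maps preserve the $\mathbb Z_2$-degree. $V^*$ is the dual space with its usual $\mathbb Z_2$-grading (a functional of parity $i$ vanishes on $V_{i+\bar 1}$), and for an endomorphism $A$ of $V$, $A^*:V^*\to V^*$ is $A^*(f)=f\circ A$. A BiHom-Jordan superalgebra is a quadruple $(\mathfrak J,\cdot,\alpha,\beta)$ with $\mathfrak J$ a $\mathbb Z_2$-graded vector space, $\cdot$ an even bilinear product and $\alpha,\beta:\mathfrak J\to\mathfrak J$ two even commuting linear maps such that for all $x,y,z,t\in\mathcal H(\mathfrak J)$: $\beta(x)\cdot\alpha(y)=(-1)^{|x||y|}\beta(y)\cdot\alpha(x)$,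 and $$\circlearrowleft_{x,y,t}(-1)^{|t|(|x|+|z|)}ass_{\alpha,\beta}\big(\beta^2(x)\cdot\alpha\beta(y),\alpha^2\beta(z),\alpha^3(t)\big)=0,$$ with cyclic sum over $(x,y,t)$ and $ass_{\alpha,\beta}(a,b,c)=(a\cdot b)\cdot\beta(c)-\alpha(a)\cdot(b\cdot c)$. It is multiplicative if $\alpha,\beta$ preserve the product and regular if they are superalgebra automorphisms. A representation of a regular multiplicative BiHom-Jordan superalgebra is a quadruple $(V,\rho,\alpha_V,\beta_V)$ with $V$ a $\mathbb Z_2$-graded vector space, $\rho:\mathfrak J\to\mathfrak{gl}(V)$ an even linear map, and $\alpha_V,\beta_V$ two even commuting linear automorphisms of $V$, such that for all $x,y,z\in\mathcal H(\mathfrak J)$ (with $\sum_{x,y,z}$ the cyclic sum over $(x,y,z)$): (R1) $\alpha_V\rho(x)=\rho(\alpha(x))\alpha_V$ and $\beta_V\rho(x)=\rho(\beta(x))\beta_V$; (R2) $\sum_{x,y,z}(-1)^{|x||z|}\rho\big(\alpha\beta^2(x)\cdot\alpha^2\beta(y)\big)\rho(\alpha^2\beta(z))\alpha_V^3=(-1)^{|x||z|}\rho\big((\beta^2(x)\cdot\alpha\beta(y))\cdot\alpha^2\beta(z)\big)\alpha_V^3\beta_V+(-1)^{|z|(|x|+|y|)}\rho(\alpha^2\beta^2(x))\rho(\alpha^2\beta(z))\rho(\alpha^2(y))\alpha_V^3\beta_V^{-1}+(-1)^{|x||y|}\rho(\alpha^2\beta^2(y))\rho(\alpha^2\beta(z))\rho(\alpha^2(x))\alpha_V^3\beta_V^{-1}$;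 (R3) $\sum_{x,y,z}(-1)^{|x||z|}\rho(\alpha^2\beta^2(x))\rho\big(\alpha\beta(y)\cdot\alpha^2(z)\big)\alpha_V^3=\sum_{x,y,z}(-1)^{|x||z|}\rho\big(\alpha\beta^2(x)\cdot\alpha^2\beta(y)\big)\rho(\alpha^2\beta(z))\alpha_V^3$. *)

(* Defs.v *)
(* Equality and choice on spaces of linear maps come from the classical axioms
   of mathcomp.classical.boolp. *)
From HB Require Import structures.
From mathcomp Require Import all_boot all_algebra.
From mathcomp Require Import boolp classical_sets.

Set Implicit Arguments.
Unset Strict Implicit.
Unset Printing Implicit Defensive.

Import GRing.Theory.
Local Open Scope ring_scope.

Definition linmap (K : comNzRingType) (U W : lmodType K) : Type :=
  {linear U -> W}.

Section LinmapModule.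
Variables (K : comNzRingType) (U W : lmodType K).
Implicit Types f g h : linmap U W.

Lemma linmapP f g : (f : U -> W) =1 g -> f = g.
Proof.
case: f g => [f cf] [g cg] /= /funext fg; subst g; congr (GRing.Linear.Pack _).
case: cf cg => [[a1] [b1]] [[a2] [b2]].
by rewrite (Prop_irrelevance a1 a2) (Prop_irrelevance b1 b2).
Qed.

HB.instance Definition _ := gen_eqMixin (linmap U W).
HB.instance Definition _ := gen_choiceMixin (linmap U W).

Definition linmap0 : linmap U W := \0.
Definition linmapN f : linmap U W := \- f.
Definition linmapD f g : linmap U W := f \+ g.
Definition linmapZ (a : K) f : linmap U W := a \*: f.

Fact linmap_addA : associative linmapD.
Proof. by move=> f g h; apply: linmapP => u /=; rewrite addrA. Qed.
Fact linmap_addC : commutative linmapD.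
Proof. by move=> f g; apply: linmapP => u /=; rewrite addrC. Qed.
Fact linmap_add0 : left_id linmap0 linmapD.
Proof. by move=> f; apply: linmapP => u /=; rewrite add0r. Qed.
Fact linmap_addN : left_inverse linmap0 linmapN linmapD.
Proof. by move=> f; apply: linmapP => u /=; rewrite addNr. Qed.
HB.instance Definition _ := GRing.isZmodule.Build (linmap U W)
  linmap_addA linmap_addC linmap_add0 linmap_addN.

Fact linmap_scaleA a b f : linmapZ a (linmapZ b f) = linmapZ (a * b) f.
Proof. by apply: linmapP => u /=; rewrite scalerA. Qed.
Fact linmap_scale1 : left_id 1 linmapZ.
Proof. by move=> f; apply: linmapP => u /=; rewrite scale1r. Qed.
Fact linmap_scaleDr : right_distributive linmapZ +%R.
Proof. by move=> a f g; apply: linmapP => u /=; rewrite scalerDr. Qed.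
Fact linmap_scaleDl f : {morph linmapZ^~ f : a b / a + b}.
Proof. by move=> a b; apply: linmapP => u /=; rewrite scalerDl. Qed.
HB.instance Definition _ := GRing.Zmodule_isLmodule.Build K (linmap U W)
  linmap_scaleA linmap_scale1 linmap_scaleDr linmap_scaleDl.

Lemma linmapDE f g u : (f + g) u = f u + g u. Proof. by []. Qed.
Lemma linmapNE f u : (- f) u = - f u. Proof. by []. Qed.
Lemma linmapZE a f u : (a *: f) u = a *: f u. Proof. by []. Qed.
Lemma linmap0E u : (0 : linmap U W) u = 0. Proof. by []. Qed.
Lemma linmap_sumE (I : Type) (r : seq I) (P : pred I) (F : I -> linmap U W) u :
  (\sum_(i <- r | P i) F i) u = \sum_(i <- r | P i) F i u.
Proof. by elim/big_rec2: _ => [//|i x f _ <-]; rewrite linmapDE. Qed.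

End LinmapModule.

(* Z_2 is represented by bool with (+) as addition and && as product. *)
HB.mixin Record isSuperspace (K : comNzRingType) V of GRing.Lmodule K V := {
  homog : bool -> set V;
  homog0 : forall i, homog i 0;
  homogP : forall i (a : K) u v, homog i u -> homog i v -> homog i (a *: u + v);
  homog_span : forall v, exists v0 v1,
    [/\ homog false v0, homog true v1 & v = v0 + v1];
  homog_direct : forall v, homog false v -> homog true v -> v = 0
}.

#[short(type="superspaceType")]
HB.structure Definition Superspace (K : comNzRingType) :=
  {V of isSuperspace K V & GRing.Lmodule K V}.

Definition even_map (K : comNzRingType) (U W : superspaceType K) (f : U -> W) :=
  forall i u, homog i u -> homog i (f u).

Section Components.
Variables (K : comNzRingType) (V : superspaceType K).
Implicit Types u v : V.

Lemma homogD i u v : homog i u -> homog i v -> homog i (u + v).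
Proof. by move=> hu hv; rewrite -[u]scale1r; apply: homogP. Qed.
Lemma homogZ i a u : homog i u -> homog i (a *: u).
Proof. by move=> hu; rewrite -[a *: u]addr0; apply: homogP => //; apply: homog0. Qed.
Lemma homogN i u : homog i u -> homog i (- u).
Proof. by rewrite -scaleN1r; apply: homogZ. Qed.

Definition component_fun (i : bool) (v : V) : V :=
  xget 0 [set u | homog i u /\ homog (~~ i) (v - u)].

Lemma component_spec i v :
  homog i (component_fun i v) /\ homog (~~ i) (v - component_fun i v).
Proof.
rewrite /component_fun; case: xgetP => [_ -> //|no].
have [v0 [v1 [h0 h1 vE]]] := homog_span v.
case: i no => no; exfalso.
  by apply: (no v1); split => //=; rewrite vE addrK.
by apply: (no v0); split => //=; rewrite vE addrC addKr.
Qed.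

Lemma component_unique i u v :
  homog i u -> homog (~~ i) (v - u) -> component_fun i v = u.
Proof.
move=> hu hvu; have [hc hvc] := component_spec i v.
apply/eqP; rewrite -subr_eq0; apply/eqP.
have h1 : homog i (component_fun i v - u) by apply: homogD => //; apply: homogN.
have h2 : homog (~~ i) (component_fun i v - u).
  have -> : component_fun i v - u = (v - u) + - (v - component_fun i v).
    by rewrite opprB addrC -addrA [RHS]addrC !addrA subrK addrC.
  by apply: homogD => //; apply: homogN.
by case: i {hu hvu hc hvc} h1 h2 => h1 h2; apply: homog_direct.
Qed.

Fact component_is_linear i : linear (component_fun i).
Proof.
move=> a u v; have [hu hu'] := component_spec i u.
have [hv hv'] := component_spec i v.
apply: component_unique; first exact: homogP.
by rewrite opprD addrACA -scalerBr; apply: homogP.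
Qed.

HB.instance Definition _ i := GRing.isLinear.Build K V V *:%R
  (component_fun i) (component_is_linear i).

Definition component i : linmap V V := component_fun i.

Lemma component_homog i v : homog i (component i v).
Proof. by have [] := component_spec i v. Qed.

Lemma component_sum v : \sum_(i : bool) component i v = v.
Proof.
rewrite big_bool /= addrC; have [h0 h1] := component_spec false v.
have -> : component true v = v - component false v.
  by apply: component_unique => //=; rewrite opprB addrC subrK.
by rewrite addrC subrK.
Qed.

Lemma component_id i v : homog i v -> component i v = v.
Proof. by move=> hv; apply: component_unique => //; rewrite subrr; apply: homog0. Qed.

Lemma component_neq0 i j v : homog j v -> i != j -> component i v = 0.
Proof.
move=> hv neq; apply: component_unique; first exact: homog0.
by rewrite subr0; case: i j neq hv => [] [].
Qed.

End Components.

Definition dual (K : comNzRingType) (V : lmodType K) : Type := linmap V K^o.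
HB.instance Definition _ (K : comNzRingType) (V : lmodType K) :=
  GRing.Lmodule.on (dual V).

Definition lincomp (K : comNzRingType) (U V W : lmodType K)
  (A : linmap V W) (B : linmap U V) : linmap U W := A \o B.

Section Transpose.
Variables (K : comNzRingType) (V W : lmodType K).

Definition transpose_fun (A : linmap V W) (f : dual W) : dual V := lincomp f A.

Fact transpose_is_linear A : linear (transpose_fun A).
Proof. by move=> a f g; apply: linmapP. Qed.
HB.instance Definition _ A := GRing.isLinear.Build K (dual W) (dual V) *:%R
  (transpose_fun A) (transpose_is_linear A).

Definition transpose (A : linmap V W) : linmap (dual W) (dual V) :=
  transpose_fun A.

End Transpose.

Section DualGrading.
Variables (K : comNzRingType) (V : superspaceType K).
Implicit Types f g : dual V.

Definition dual_homog (i : bool) : set (dual V) :=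
  [set f | forall v, homog (~~ i) v -> f v = 0].

Fact dual_homog0 i : dual_homog i 0.
Proof. by []. Qed.

Fact dual_homogP i (a : K) f g :
  dual_homog i f -> dual_homog i g -> dual_homog i (a *: f + g).
Proof. by move=> hf hg v hv; rewrite linmapDE linmapZE hf // hg // scaler0 addr0. Qed.

Fact dual_homog_span f : exists f0 f1,
  [/\ dual_homog false f0, dual_homog true f1 & f = f0 + f1].
Proof.
exists (transpose (component V false) f), (transpose (component V true) f).
split=> [v hv|v hv|].
- by rewrite /= (component_neq0 hv) // linear0.
- by rewrite /= (component_neq0 hv) // linear0.
apply: linmapP => v; rewrite linmapDE /= -linearD; congr (f _).
by rewrite -[LHS]component_sum big_bool addrC.
Qed.

Fact dual_homog_direct f : dual_homog false f -> dual_homog true f -> f = 0.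
Proof.
move=> h0 h1; apply: linmapP => v; rewrite -[v]component_sum big_bool linearD.
by rewrite h0 ?h1 ?addr0 //; apply: component_homog.
Qed.

HB.instance Definition _ := isSuperspace.Build K (dual V)
  dual_homog0 dual_homogP dual_homog_span dual_homog_direct.

End DualGrading.

Record linaut (K : comNzRingType) (V : lmodType K) := LinAut {
  linaut_map :> {linear V -> V};
  linaut_inv : {linear V -> V};
  linautK : cancel linaut_map linaut_inv;
  linautVK : cancel linaut_inv linaut_map
}.

Section DualAutomorphism.
Variables (K : comNzRingType) (V : lmodType K) (a : linaut V).

Fact transpose_linautK : cancel (transpose (linaut_inv a)) (transpose a).
Proof. by move=> f; apply: linmapP => v /=; rewrite linautK. Qed.
Fact transpose_linautVK : cancel (transpose a) (transpose (linaut_inv a)).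
Proof. by move=> f; apply: linmapP => v /=; rewrite linautVK. Qed.

(* (a^-1)^* *)
Definition linaut_dual : linaut (dual V) :=
  LinAut transpose_linautK transpose_linautVK.

End DualAutomorphism.

(* Cyclic sum over (x, y, z), the parities i, j, k moving along. *)
Definition cyclic_sum (T : Type) (M : nmodType)
  (F : bool -> T -> bool -> T -> bool -> T -> M)
  (i : bool) (x : T) (j : bool) (y : T) (k : bool) (z : T) : M :=
  F i x j y k z + F j y k z i x + F k z i x j y.

Section BiHomJordan.
Variables (K : comNzRingType) (J : superspaceType K).
Variables (mul : {bilinear J -> J -> J}) (alpha beta : {linear J -> J}).

Definition bihom_ass (a b c : J) : J :=
  mul (mul a b) (beta c) - mul (alpha a) (mul b c).

Record bihom_jordan_superalgebra : Prop := BiHomJordanSuperalgebra {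
  bj_mul_even : forall i j x y,
    homog i x -> homog j y -> homog (i (+) j) (mul x y);
  bj_alpha_even : even_map alpha;
  bj_beta_even : even_map beta;
  bj_commute : forall x, alpha (beta x) = beta (alpha x);
  bj_supercomm : forall i j x y, homog i x -> homog j y ->
    mul (beta x) (alpha y) =
      (-1) ^+ (i && j) *: mul (beta y) (alpha x);
  bj_jordan : forall i j k l x y z t,
    homog i x -> homog j y -> homog k z -> homog l t ->
    cyclic_sum (fun i x j y l t =>
      (-1) ^+ (l && (i (+) k)) *:
        bihom_ass (mul (beta (beta x)) (alpha (beta y)))
                  (alpha (alpha (beta z)))
                  (alpha (alpha (alpha t)))) i x j y l t = 0
}.

Definition preserves_mul (f : J -> J) := {morph f : x y / mul x y}.

Definition multiplicative_bihom := preserves_mul alpha /\ preserves_mul beta.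

Definition superalgebra_automorphism (f : J -> J) :=
  [/\ even_map f, bijective f & preserves_mul f].

Definition regular_bihom :=
  superalgebra_automorphism alpha /\ superalgebra_automorphism beta.

(* A and B stand for alpha_V and beta_V, and B' for the inverse of beta_V. *)
Record bihom_representation (V : superspaceType K)
  (rho : {linear J -> linmap V V}) (A B : linaut V) : Prop :=
  BiHomRepresentation {
  rep_even : forall i j x v,
    homog i x -> homog j v -> homog (i (+) j) (rho x v);
  rep_A_even : even_map A;
  rep_B_even : even_map B;
  rep_commute : forall v, A (B v) = B (A v);
  rep_alpha : forall i x v, homog i x -> A (rho x v) = rho (alpha x) (A v);
  rep_beta : forall i x v, homog i x -> B (rho x v) = rho (beta x) (B v);
  rep_R2 : forall i j k x y z v,
    homog i x -> homog j y -> homog k z ->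
    let A3 := iter 3 A in
    let B' := linaut_inv B in
    cyclic_sum (fun i x j y k z =>
      (-1) ^+ (i && k) *:
        rho (mul (alpha (beta (beta x))) (alpha (alpha (beta y))))
          (rho (alpha (alpha (beta z))) (A3 v))) i x j y k z
    = (-1) ^+ (i && k) *:
        rho (mul (mul (beta (beta x)) (alpha (beta y))) (alpha (alpha (beta z))))
          (A3 (B v))
    + (-1) ^+ (k && (i (+) j)) *:
        rho (alpha (alpha (beta (beta x))))
          (rho (alpha (alpha (beta z)))
            (rho (alpha (alpha y)) (A3 (B' v))))
    + (-1) ^+ (i && j) *:
        rho (alpha (alpha (beta (beta y))))
          (rho (alpha (alpha (beta z)))
            (rho (alpha (alpha x)) (A3 (B' v))));
  rep_R3 : forall i j k x y z v,
    homog i x -> homog j y -> homog k z ->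
    let A3 := iter 3 A in
    cyclic_sum (fun i x j y k z =>
      (-1) ^+ (i && k) *:
        rho (alpha (alpha (beta (beta x))))
          (rho (mul (alpha (beta y)) (alpha (alpha z))) (A3 v))) i x j y k z
    = cyclic_sum (fun i x j y k z =>
      (-1) ^+ (i && k) *:
        rho (mul (alpha (beta (beta x))) (alpha (alpha (beta y))))
          (rho (alpha (alpha (beta z))) (A3 v))) i x j y k z
}.

End BiHomJordan.

Section DualRepresentation.
Variables (K : comNzRingType) (J V : superspaceType K).
Variable rho : {linear J -> linmap V V}.

(* The bilinear extension of the formula for homogeneous x and f: see
   rho_tilde_homog. *)
Definition rho_tilde (x : J) (f : dual V) : dual V :=
  \sum_(i : bool) \sum_(j : bool)
    (-1) ^+ (j && i) *:
      transpose (rho (component J i x)) (component (dual V) j f).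

Lemma rho_tilde_homog (i j : bool) (x : J) (f : dual V) :
  homog i x -> homog j f ->
  rho_tilde x f = (-1) ^+ (j && i) *: transpose (rho x) f.
Proof.
move=> hx hf; rewrite /rho_tilde.
rewrite (bigD1 i) //= [X in _ + X]big1 => [|k ki]; last first.
  apply: big1 => l _; rewrite (component_neq0 hx ki) linear0.
  by apply: linmapP => v; rewrite linmapZE /= linear0 scaler0.
rewrite addr0 (bigD1 j) //= [X in _ + X]big1 => [|k kj].
  by rewrite addr0 !component_id.
by rewrite (component_neq0 hf kj) linear0 scaler0.
Qed.

Fact rho_tilde_linear_r x : linear (rho_tilde x).
Proof.
move=> a f g; rewrite /rho_tilde scaler_sumr -big_split; apply: eq_bigr => i _.
rewrite scaler_sumr -big_split; apply: eq_bigr => j _ /=.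
rewrite (linearP (component (dual V) j)) (linearP (transpose _)).
by rewrite scalerDr !scalerA mulrC.
Qed.

Fact rho_tilde_linear_l f : linear (rho_tilde^~ f).
Proof.
move=> a x y; rewrite /rho_tilde scaler_sumr -big_split; apply: eq_bigr => i _.
rewrite scaler_sumr -big_split; apply: eq_bigr => j _ /=.
rewrite scalerA mulrC -scalerA -scalerDr; congr (_ *: _).
apply: linmapP => v; rewrite linmapDE linmapZE /= (linearP (component J i)).
by rewrite (linearP rho) linmapDE linmapZE linearP.
Qed.

Variables (beta : {linear J -> J}) (B : linaut V).

Definition rho_star_fun (x : J) (f : dual V) : dual V :=
  rho_tilde (beta x)
    (transpose (lincomp (linaut_inv B) (linaut_inv B)) f).

Fact rho_star_fun_linear x : linear (rho_star_fun x).
Proof. by move=> a f g; rewrite /rho_star_fun linearP rho_tilde_linear_r. Qed.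
HB.instance Definition _ x := GRing.isLinear.Build K (dual V) (dual V) *:%R
  (rho_star_fun x) (rho_star_fun_linear x).

Definition rho_star_map (x : J) : linmap (dual V) (dual V) := rho_star_fun x.

Fact rho_star_map_linear : linear rho_star_map.
Proof.
move=> a x y; apply: linmapP => f; rewrite linmapDE linmapZE /=.
by rewrite /rho_star_fun linearP rho_tilde_linear_l.
Qed.
HB.instance Definition _ := GRing.isLinear.Build K J (linmap (dual V) (dual V))
  *:%R rho_star_map rho_star_map_linear.

Definition rho_star : {linear J -> linmap (dual V) (dual V)} := rho_star_map.

Lemma rho_starE x f : rho_star x f =
  rho_tilde (beta x) (transpose (lincomp (linaut_inv B) (linaut_inv B)) f).
Proof. by []. Qed.

End DualRepresentation.

(* Main.v *)
(* Transposition reverses products, at the price of the Koszul sign of the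
   reversal.  Hence the two cyclic sums of (R3) are exchanged, as are the two
   triple products of (R2), so that (R3) for V^* is (R3) for V, while (R2) for
   V^* is (R2) for V after its left-hand side is replaced using (R3).  Moving all
   powers of beta_V to the left shows that both are transposes of the axioms of V
   at beta^2(x), beta^2(y), beta^2(z). *)
Require Import Defs.
From mathcomp Require Import all_boot all_algebra.

Set Implicit Arguments.
Unset Strict Implicit.
Unset Printing Implicit Defensive.

Import GRing.Theory.
Local Open Scope ring_scope.

(** * Homogeneous components, functionals and even automorphisms *)

Lemma linear_homog_eq (K : comNzRingType) (U : superspaceType K)
    (W : lmodType K) (g h : {linear U -> W}) :
  (forall j u, homog j u -> g u = h u) -> g =1 h.
Proof.
move=> gh u; rewrite -[u]component_sum !linear_sum.
by apply: eq_bigr => j _; apply: gh (component_homog j u).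
Qed.

Lemma linear_comb3 (K : comNzRingType) (U W : lmodType K) (g : {linear U -> W})
    a b c u v w :
  g (a *: u + b *: v + c *: w) = a *: g u + b *: g v + c *: g w.
Proof. by rewrite !linearD !linearZ. Qed.

Lemma linmap_comb3 (K : comNzRingType) (U W : lmodType K) a b c
    (f g h : linmap U W) u :
  (a *: f + b *: g + c *: h) u = a *: f u + b *: g u + c *: h u.
Proof. by []. Qed.

(** Dual parity is a vanishing condition: cutting [f] down by the projection leaves a remainder that
    vanishes on parity [j], and components are unique. *)
Lemma component_dual (K : comNzRingType) (V : superspaceType K) j
    (f : dual V) :
  component (dual V) j f = transpose (component V j) f.
Proof.
apply: component_unique => v hv.
  by rewrite /= (component_neq0 hv) ?linear0 //; case: j {hv}.
rewrite linmapDE linmapNE /= component_id ?subrr //.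
by rewrite negbK in hv.
Qed.

(** An even map commutes with the projections, so [A] kills the wrong-parity component of the
    preimage; injectivity makes that component zero. *)
Lemma linaut_inv_even (K : comNzRingType) (V : superspaceType K)
    (A : linaut V) :
  even_map A -> even_map (linaut_inv A).
Proof.
move=> evA i v hv; set u := linaut_inv A v.
have compA : component V (~~ i) u = 0.
  apply: (can_inj (linautK A)); rewrite linear0.
  have -> : A (component V (~~ i) u) = component V (~~ i) (A u).
    rewrite -{2}[u]component_sum !linear_sum big_bool.
    by case: (i) => /=; rewrite (component_id (evA _ _ (component_homog _ _)))
      (component_neq0 (evA _ _ (component_homog _ _))) ?addr0 ?add0r.
  by rewrite /u linautVK (component_neq0 hv) //; case: (i).
rewrite -[u]component_sum big_bool.
by case: i {hv} compA => /= ->; rewrite ?addr0 ?add0r; apply: component_homog.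
Qed.

Lemma linaut_dual_even (K : comNzRingType) (V : superspaceType K)
    (A : linaut V) :
  even_map A -> even_map (linaut_dual A).
Proof. by move=> evA i f hf v hv /=; apply: hf; apply: linaut_inv_even. Qed.

(** * Koszul signs as operators *)

Section ParityTwist.
Variables (K : comNzRingType) (V : superspaceType K).

(* Acts on homogeneous vectors of parity j as the Koszul sign (-1)^(ij); with it
   the formula for rho_tilde x f holds without homogeneity of f. *)
Definition parity_twist (i : bool) : linmap V V :=
  \sum_(j : bool) (-1) ^+ (j && i) *: component V j.

Lemma parity_twist_homog i j v :
  homog j v -> parity_twist i v = (-1) ^+ (j && i) *: v.
Proof.
move=> hv; rewrite linmap_sumE big_bool !linmapZE.
by case: j hv => hv; rewrite (component_id hv) (component_neq0 hv) //= scaler0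
  ?addr0 ?add0r.
Qed.

Lemma parity_twist_comp i j v :
  parity_twist i (parity_twist j v) = parity_twist (i (+) j) v.
Proof.
(* Composites are packaged as linear maps, so homogeneous vectors suffice; on these a twist is a
   scalar. *)
apply: (linear_homog_eq (g := lincomp _ _)) => k u hu /=.
rewrite (parity_twist_homog j hu) linearZ /= !(parity_twist_homog _ hu) scalerA.
by rewrite -signr_addb addbC; case: i j k {hu} => [] [] [].
Qed.

Lemma parity_twist_even (A : {linear V -> V}) i v :
  even_map A -> A (parity_twist i v) = parity_twist i (A v).
Proof.
move=> evA; pose A' : linmap V V := A.
apply: (linear_homog_eq (g := lincomp A' _) (h := lincomp _ A')) => k u hu /=.
by rewrite (parity_twist_homog i hu) linearZ (parity_twist_homog i (evA _ _ hu)).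
Qed.

(** The parity-[j] component of [f] sees only the parity-[j] component of its argument, so the sign
    can be moved from [f] onto the vector. *)
Lemma rho_tilde_homogE (J : superspaceType K) (rho : {linear J -> linmap V V})
    i x (f : dual V) v :
  homog i x -> rho_tilde rho x f v = f (parity_twist i (rho x v)).
Proof.
move=> hx; rewrite /rho_tilde exchange_big !linmap_sumE linear_sum.
apply: eq_bigr => j _; rewrite big_bool linmapDE !linmapZE linearZ /=.
by rewrite component_dual; case: i hx => hx;
  rewrite (component_id hx) (component_neq0 hx) // [rho 0]linear0 linear0 scaler0
    ?addr0 ?add0r.
Qed.

End ParityTwist.

(** * Commutation rules and products of [rho_star] *)

Section DualRepresentation.
Variables (K : comNzRingType) (J V : superspaceType K).
Variables (mul : {bilinear J -> J -> J}) (alpha beta : {linear J -> J}).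
Variables (rho : {linear J -> linmap V V}) (A B : linaut V).
Hypotheses (Jjord : bihom_jordan_superalgebra mul alpha beta)
  (Jmult : multiplicative_bihom mul alpha beta)
  (Vrep : bihom_representation mul alpha beta rho A B).

Local Notation A' := (linaut_inv A).
Local Notation B' := (linaut_inv B).
Local Notation P := (@parity_twist K V).
Local Notation rhos := (rho_star rho beta B).
Local Notation Ad := (linaut_dual A).
Local Notation Bd := (linaut_dual B).

Let beta_even := bj_beta_even Jjord.
Let evA := rep_A_even Vrep.
Let evB := rep_B_even Vrep.
Let evA' := linaut_inv_even evA.
Let evB' := linaut_inv_even evB.

(** [rho x] shifts parity by [i], which changes the twist's sign by $(-1)^{ij}$. *)
Lemma parity_twist_rho i j x v :
  homog i x -> P j (rho x v) = (-1) ^+ (i && j) *: rho x (P j v).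
Proof.
move=> hx.
pose g : linmap V V := lincomp (P j) (rho x).
pose h : linmap V V := (-1) ^+ (i && j) *: lincomp (rho x) (P j).
apply: (linear_homog_eq (g := g) (h := h)) => k u hu.
rewrite /g /h linmapZE /= (parity_twist_homog j hu).
rewrite (parity_twist_homog j (rep_even Vrep hx hu)) linearZ /= scalerA.
by rewrite -signr_addb; case: i j k {g h hx hu} => [] [] [].
Qed.

Lemma invA_B v : B (A' v) = A' (B v).
Proof.
by apply: (can_inj (linautK A)); rewrite linautVK (rep_commute Vrep) linautVK.
Qed.

Lemma invB_invA v : B' (A' v) = A' (B' v).
Proof. by apply: (can_inj (linautK B)); rewrite invA_B !linautVK. Qed.

Lemma invB_rho i x v : homog i x -> rho x (B' v) = B' (rho (beta x) v).
Proof.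
by move=> hx; apply: (can_inj (linautK B)); rewrite (rep_beta Vrep _ hx) !linautVK.
Qed.

Lemma invA_rho i x v : homog i x -> rho x (A' v) = A' (rho (alpha x) v).
Proof.
by move=> hx; apply: (can_inj (linautK A)); rewrite (rep_alpha Vrep _ hx) !linautVK.
Qed.

Lemma iter_beta_even n i x : homog i x -> homog i (iter n beta x).
Proof. by move=> hx; elim: n => //= n; apply: beta_even. Qed.

Lemma iter_invB_rho n i x v :
  homog i x -> rho x (iter n B' v) = iter n B' (rho (iter n beta x) v).
Proof.
move=> hx; elim: n x hx => //= n IHn x hx.
by rewrite (invB_rho _ hx) (IHn _ (beta_even hx)) -iterSr.
Qed.

Lemma rho_star_homog i x (f : dual V) v :
  homog i x -> rhos x f v = f (P i (iter 2 B' (rho (beta x) v))).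
Proof.
move=> hx; rewrite rho_starE (rho_tilde_homogE _ _ _ (beta_even hx)) /=.
by rewrite !parity_twist_even.
Qed.

(** Transposition reverses the factors. The sign comes from pulling the twist of [x] through
    [rho (beta y)]; the inner $B'^2$ crossing the same factor raises its [beta] to [iter 3 beta]. *)
Lemma rho_star2 i j x y (f : dual V) v :
  homog i x -> homog j y ->
  rhos x (rhos y f) v =
    (-1) ^+ (i && j) *:
      f (P (i (+) j) (iter 4 B' (rho (iter 3 beta y) (rho (beta x) v)))).
Proof.
move=> hx hy; rewrite (rho_star_homog _ _ hx) (rho_star_homog _ _ hy).
have by1 := beta_even hy.
have -> (u : V) : rho (beta y) (P i u) = (-1) ^+ (i && j) *: P i (rho (beta y) u).
  by rewrite (parity_twist_rho _ _ by1) scalerA -signr_addb andbC addbb scale1r.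
rewrite (iter_invB_rho _ _ by1) /= !linearZ /=; congr (_ *: f _).
by rewrite !(parity_twist_even _ _ evB') parity_twist_comp addbC.
Qed.

(** Reversing three factors exchanges each pair once, whence the exponent $ij+ik+jk$. *)
Lemma rho_star3 i j k x y z (f : dual V) v :
  homog i x -> homog j y -> homog k z ->
  rhos x (rhos y (rhos z f)) v =
    (-1) ^+ ((i && j) (+) (i && k) (+) (j && k)) *:
      f (P (i (+) j (+) k) (iter 6 B'
        (rho (iter 5 beta z) (rho (iter 3 beta y) (rho (beta x) v))))).
Proof.
move=> hx hy hz; rewrite (rho_star2 _ _ hx hy) (rho_star_homog _ _ hz).
have bz := beta_even hz.
set p := i (+) j.
have -> (w : V) : rho (beta z) (P p w) = (-1) ^+ (p && k) *: P p (rho (beta z) w).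
  by rewrite (parity_twist_rho _ _ bz) scalerA -signr_addb andbC addbb scale1r.
rewrite (iter_invB_rho _ _ bz) /= !linearZ /= scalerA -signr_addb.
congr (_ ^+ _ *: f _); first by rewrite /p; case: i j k {hx hy hz p bz} => [] [] [].
by rewrite !(parity_twist_even _ _ evB') parity_twist_comp addbC.
Qed.

Lemma rho_star_even i j x (f : dual V) :
  homog i x -> homog j f -> homog (i (+) j) (rhos x f).
Proof.
move=> hx hf v hv; rewrite (rho_star_homog _ _ hx).
have h : homog (~~ j) (iter 2 B' (rho (beta x) v)).
  do 2!apply: evB'; have := rep_even Vrep (beta_even hx) hv.
  by case: (i); case: (j).
by rewrite (parity_twist_homog _ h) linearZ /= hf // scaler0.
Qed.

(** * The axioms of $V$ in shifted form *)

Lemma homog_mul i j x y : homog i x -> homog j y -> homog (i (+) j) (mul x y).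
Proof. exact: (bj_mul_even Jjord). Qed.

Let alpha_even := bj_alpha_even Jjord.
Let alpha_beta := bj_commute Jjord.
Let beta_mul := Jmult.2.

Lemma rho3_invB i j k x y z v :
  homog i x -> homog j y -> homog k z ->
  rho x (rho y (rho z (B' v))) = B' (rho (beta x) (rho (beta y) (rho (beta z) v))).
Proof. by move=> hx hy hz; rewrite (invB_rho _ hz) (invB_rho _ hy) (invB_rho _ hx). Qed.

Lemma iter_A_cancel v : A (A (A (A' (A' (A' v))))) = v.
Proof. by rewrite !linautVK. Qed.

(** Prepares (R2) for comparison with products of [rho_star], where collecting the powers of [B'] on
    the left leaves exactly these powers of [beta]. *)
Lemma rep_R2_shift i j k x y z v :
  homog i x -> homog j y -> homog k z ->
  cyclic_sum (fun i x j y k z =>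
    (-1) ^+ (i && k) *:
      rho (mul (iter 4 beta (alpha x)) (iter 3 beta (alpha (alpha y))))
        (rho (iter 3 beta (alpha (alpha z))) v)) i x j y k z
  = (-1) ^+ (i && k) *:
      B (rho (mul (mul (iter 3 beta x) (iter 2 beta (alpha y)))
                  (iter 2 beta (alpha (alpha z)))) v)
  + (-1) ^+ (k && (i (+) j)) *:
      B' (rho (iter 5 beta (alpha (alpha x)))
        (rho (iter 4 beta (alpha (alpha z)))
          (rho (iter 3 beta (alpha (alpha y))) v)))
  + (-1) ^+ (i && j) *:
      B' (rho (iter 5 beta (alpha (alpha y)))
        (rho (iter 4 beta (alpha (alpha z)))
          (rho (iter 3 beta (alpha (alpha x))) v))).
Proof.
move=> hx hy hz.
(* The third inverse power of [A] on the vector absorbs the factor $\alpha_V^3$. *)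
have := rep_R2 Vrep (A' (A' (A' v))) (iter_beta_even 2 hx) (iter_beta_even 2 hy)
  (iter_beta_even 2 hz).
have hm : homog (i (+) j (+) k) (mul (mul (iter 3 beta x) (iter 2 beta (alpha y)))
                  (iter 2 beta (alpha (alpha z)))).
  by do ![apply: homog_mul | apply: beta_even | apply: alpha_even].
rewrite (rep_beta Vrep _ hm) /= /cyclic_sum !invB_invA !invA_B !iter_A_cancel.
rewrite !alpha_beta !beta_mul => ->.
by rewrite (rho3_invB (i := i) (j := k) (k := j))
  ?(rho3_invB (i := j) (j := k) (k := i)) //;
  do ![apply: beta_even | apply: alpha_even].
Qed.

Lemma rep_R3_shift i j k x y z v :
  homog i x -> homog j y -> homog k z ->
  cyclic_sum (fun i x j y k z =>
    (-1) ^+ (i && k) *: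
      rho (iter 4 beta (alpha (alpha x)))
        (rho (mul (iter 3 beta (alpha y)) (iter 2 beta (alpha (alpha z)))) v))
    i x j y k z
  = cyclic_sum (fun i x j y k z =>
    (-1) ^+ (i && k) *:
      rho (mul (iter 4 beta (alpha x)) (iter 3 beta (alpha (alpha y))))
        (rho (iter 3 beta (alpha (alpha z))) v)) i x j y k z.
Proof.
move=> hx hy hz.
have := rep_R3 Vrep (A' (A' (A' v))) (iter_beta_even 2 hx) (iter_beta_even 2 hy)
  (iter_beta_even 2 hz).
by rewrite /= iter_A_cancel /cyclic_sum !alpha_beta.
Qed.

(** * Terms of the dual axioms as transposes *)

Lemma rho_star_R3_left i j k x y z (g : dual V) v :
  homog i x -> homog j y -> homog k z ->
  (-1) ^+ (i && k) *:
    rhos (alpha (alpha (beta (beta x))))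
      (rhos (mul (alpha (beta y)) (alpha (alpha z))) g) v
  = (-1) ^+ (j && i) *: g (P (i (+) j (+) k) (iter 4 B'
      (rho (mul (iter 4 beta (alpha y)) (iter 3 beta (alpha (alpha z))))
        (rho (iter 3 beta (alpha (alpha x))) v)))).
Proof.
move=> hx hy hz; rewrite (rho_star2 (i := i) (j := j (+) k)); first last.
- by apply: homog_mul; do ![apply: beta_even | apply: alpha_even].
- by do ![apply: beta_even | apply: alpha_even].
(* The reversal sign $i(j+k)$ turns $ik$ into $ij$, the exponent of the right-hand term of (R3) at
   $(y,z,x)$. *)
rewrite scalerA -signr_addb addbA !alpha_beta /= !beta_mul.
by congr (_ ^+ _ *: _); case: (i); case: (j); case: (k).
Qed.

Lemma rho_star_R3_right i j k x y z (g : dual V) v :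
  homog i x -> homog j y -> homog k z ->
  (-1) ^+ (i && k) *:
    rhos (mul (alpha (beta (beta x))) (alpha (alpha (beta y))))
      (rhos (alpha (alpha (beta z))) g) v
  = (-1) ^+ (k && j) *: g (P (i (+) j (+) k) (iter 4 B'
      (rho (iter 4 beta (alpha (alpha z)))
        (rho (mul (iter 3 beta (alpha x)) (iter 2 beta (alpha (alpha y)))) v)))).
Proof.
move=> hx hy hz; rewrite (rho_star2 (i := i (+) j) (j := k)); first last.
- by do ![apply: beta_even | apply: alpha_even].
- by apply: homog_mul; do ![apply: beta_even | apply: alpha_even].
(* Here $(i+j)k$ turns $ik$ into $jk$, the exponent of the left-hand term of (R3) at $(z,x,y)$. *)
rewrite scalerA -signr_addb !alpha_beta /= !beta_mul.
by congr (_ ^+ _ *: _); case: (i); case: (j); case: (k).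
Qed.

(** With [p] the total parity of [x], [y], [z], this one functional evaluates all terms of the dual
    (R2) and (R3) from terms on $V$, up to sign; equalities on $V$ thus transfer by applying it. *)
Definition twisted_dual (p : bool) (f : dual V) : dual V :=
  iter 4 Bd (transpose (P p) (iter 3 Ad f)).

Lemma twisted_dualE p f u :
  twisted_dual p f u = iter 3 Ad f (P p (iter 4 B' u)).
Proof. by []. Qed.

(** One [rho_star] gives $B'^2$ and [Bd] a third [B']; against the fourth power in [twisted_dual]
    this leaves the factor [B] of (R2). *)
Lemma rho_star_R2_mul i j k x y z f v :
  homog i x -> homog j y -> homog k z ->
  rhos (mul (mul (beta (beta x)) (alpha (beta y))) (alpha (alpha (beta z))))
    (iter 3 Ad (Bd f)) v
  = twisted_dual (i (+) j (+) k) f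
      (B (rho (mul (mul (iter 3 beta x) (iter 2 beta (alpha y)))
                   (iter 2 beta (alpha (alpha z)))) v)).
Proof.
move=> hx hy hz; rewrite (rho_star_homog (i := i (+) j (+) k)); last first.
  by do ![apply: homog_mul | apply: beta_even | apply: alpha_even].
rewrite twisted_dualE !beta_mul !alpha_beta /= linautK.
by rewrite !invB_invA !(parity_twist_even _ _ evB').
Qed.

(** Three factors give $B'^6$ and the inverse of [Bd] cancels one, so one [B'] remains beyond the
    fourth power. The outer arguments [x] and [y] change places. *)
Lemma rho_star_R2_triple i j k x y z f v :
  homog i x -> homog j y -> homog k z ->
  rhos (alpha (alpha (beta (beta x)))) (rhos (alpha (alpha (beta z)))
    (rhos (alpha (alpha y)) (iter 3 Ad (linaut_inv Bd f)))) v
  = (-1) ^+ ((i && k) (+) (i && j) (+) (k && j)) *: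
    twisted_dual (i (+) j (+) k) f
      (B' (rho (iter 5 beta (alpha (alpha y)))
        (rho (iter 4 beta (alpha (alpha z)))
          (rho (iter 3 beta (alpha (alpha x))) v)))).
Proof.
move=> hx hy hz; rewrite (rho_star3 (i := i) (j := k) (k := j));
  do ?[apply: beta_even | apply: alpha_even] => //.
rewrite twisted_dualE !alpha_beta /= [i (+) j (+) k]addbAC.
by rewrite !invA_B (parity_twist_even _ _ evB) linautVK.
Qed.

Lemma rho_star_R3_left_sum i j k x y z f v :
  homog i x -> homog j y -> homog k z ->
  cyclic_sum (fun i x j y k z =>
    (-1) ^+ (i && k) *:
      rhos (alpha (alpha (beta (beta x))))
        (rhos (mul (alpha (beta y)) (alpha (alpha z))) (iter 3 Ad f)))
    i x j y k z v
  = twisted_dual (i (+) j (+) k) f (cyclic_sum (fun i x j y k z =>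
    (-1) ^+ (i && k) *:
      rho (mul (iter 4 beta (alpha x)) (iter 3 beta (alpha (alpha y))))
        (rho (iter 3 beta (alpha (alpha z))) v)) i x j y k z).
Proof.
move=> hx hy hz; rewrite /cyclic_sum !linmapDE !linmapZE !linearD !linearZ.
rewrite (rho_star_R3_left _ _ hx hy hz) (rho_star_R3_left _ _ hy hz hx).
(* The terms arrive as $(y,z,x)$, $(z,x,y)$, $(x,y,z)$ and are rotated back. *)
rewrite (rho_star_R3_left _ _ hz hx hy) addrC addrA.
by rewrite !twisted_dualE -[k (+) i (+) j]addbA [k (+) (i (+) j)]addbC
  [j (+) k (+) i]addbC !addbA.
Qed.

Lemma rho_star_R3_right_sum i j k x y z f v :
  homog i x -> homog j y -> homog k z ->
  cyclic_sum (fun i x j y k z =>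
    (-1) ^+ (i && k) *:
      rhos (mul (alpha (beta (beta x))) (alpha (alpha (beta y))))
        (rhos (alpha (alpha (beta z))) (iter 3 Ad f)))
    i x j y k z v
  = twisted_dual (i (+) j (+) k) f (cyclic_sum (fun i x j y k z =>
    (-1) ^+ (i && k) *:
      rho (iter 4 beta (alpha (alpha x)))
        (rho (mul (iter 3 beta (alpha y)) (iter 2 beta (alpha (alpha z)))) v))
    i x j y k z).
Proof.
move=> hx hy hz; rewrite /cyclic_sum !linmapDE !linmapZE !linearD !linearZ.
rewrite (rho_star_R3_right _ _ hx hy hz) (rho_star_R3_right _ _ hy hz hx).
rewrite (rho_star_R3_right _ _ hz hx hy).
rewrite !twisted_dualE -[k (+) i (+) j]addbA [k (+) (i (+) j)]addbC
  [j (+) k (+) i]addbC !addbA.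
(* Here the order is $(z,x,y)$, $(x,y,z)$, $(y,z,x)$, so the rotation is the opposite one. *)
by rewrite -addrA addrC.
Qed.

End DualRepresentation.

(** * Verification of the axioms on the dual space *)

Theorem theorem3p1 (K : closedFieldType) (charK0 : [pchar K] =i pred0)
    (J : superspaceType K) (mul : {bilinear J -> J -> J})
    (alpha beta : {linear J -> J})
    (V : superspaceType K) (rho : {linear J -> linmap V V})
    (alphaV betaV : linaut V) :
  bihom_jordan_superalgebra mul alpha beta ->
  multiplicative_bihom mul alpha beta ->
  regular_bihom mul alpha beta ->
  bihom_representation mul alpha beta rho alphaV betaV ->
  bihom_representation mul alpha beta (rho_star rho beta betaV)
    (linaut_dual alphaV) (linaut_dual betaV).
Proof.
move=> Jjord Jmult _ Vrep.
have evA := rep_A_even Vrep; have evB := rep_B_even Vrep.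
have evA' := linaut_inv_even evA; have evB' := linaut_inv_even evB.
split.
- by move=> i j x f hx hf; exact: (rho_star_even Jjord Vrep hx hf).
- exact: linaut_dual_even.
- exact: linaut_dual_even.
- by move=> f; apply: linmapP => v /=; rewrite (invB_invA Vrep).
- move=> i x f hx; apply: linmapP => v /=.
  rewrite (rho_star_homog Jjord Vrep _ _ hx).
  rewrite (rho_star_homog Jjord Vrep _ _ (bj_alpha_even Jjord hx)) /=.
  rewrite (invA_rho Vrep _ (bj_beta_even Jjord hx)) (bj_commute Jjord).
  by rewrite !(invB_invA Vrep) (parity_twist_even _ _ evA').
- move=> i x f hx; apply: linmapP => v /=.
  rewrite (rho_star_homog Jjord Vrep _ _ hx).
  rewrite (rho_star_homog Jjord Vrep _ _ (bj_beta_even Jjord hx)) /=.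
  rewrite (invB_rho Vrep _ (bj_beta_even Jjord hx)).
  by rewrite !(parity_twist_even _ _ evB').
- move=> i j k x y z f hx hy hz A3 Binv; apply: linmapP => v.
  apply: etrans (rho_star_R3_right_sum Jjord Jmult Vrep f v hx hy hz) _.
  (* The transposed sum is the left-hand side of (R3) on $V$: inside the functional, (R3) and then
     (R2) rewrite it. *)
  apply: etrans (congr1 (twisted_dual alphaV betaV _ f)
    (rep_R3_shift Jjord Vrep v hx hy hz)) _.
  apply: etrans (congr1 (twisted_dual alphaV betaV _ f)
    (rep_R2_shift Jjord Jmult Vrep v hx hy hz)) _.
  apply: etrans (linear_comb3 _ _ _ _ _ _ _) _.
  apply: etrans _ (esym (linmap_comb3 _ _ _ _ _ _ _)).
  (* Reversal exchanges the two triple products, so they are matched crosswise; its sign $ij+ik+jk$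
     interchanges the exponents $ij$ and $k(i+j)$. *)
  rewrite -[RHS]addrA [X in _ = _ + X]addrC -[LHS]addrA.
  congr (_ + (_ + _)).
  + by congr (_ *: _); apply: esym; apply: rho_star_R2_mul.
  + apply: esym; apply: etrans (congr1 ( *:%R _)
      (rho_star_R2_triple Jjord Vrep f v hy hx hz)) _.
    rewrite scalerA -signr_addb [j (+) i]addbC.
    by congr (_ ^+ _ *: _); case: (i); case: (j); case: (k).
  + apply: esym; apply: etrans (congr1 ( *:%R _)
      (rho_star_R2_triple Jjord Vrep f v hx hy hz)) _.
    rewrite scalerA -signr_addb.
    by congr (_ ^+ _ *: _); case: (i); case: (j); case: (k).
- move=> i j k x y z f hx hy hz A3; apply: linmapP => v.
  apply: etrans (rho_star_R3_left_sum Jjord Jmult Vrep f v hx hy hz) _.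
  (* Transposition exchanges the two sides, so (R3) on $V$ enters with its sides in the opposite
     order. *)
  apply: esym; apply: etrans (congr1 (twisted_dual alphaV betaV _ f)
    (rep_R3_shift Jjord Vrep v hx hy hz)).
  exact: rho_star_R3_right_sum.
Qed.
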